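(* Let $k$ be a finite field of order $q$. Let $W_1$ be the $T$-space of $k[x]_0$ generated by $x+x^{q}$ and $x^{q+1}$. Then $W_1$ is a maximal $T$-space of $k[x]_0$; that is, $W_1\neq k[x]_0$ and there is no $T$-space $V$ of $k[x]_0$ with $W_1\subsetneq V\subsetneq k[x]_0$.
   Context: $k[x]_0$ denotes the free associative $k$-algebra without unit on one generator $x$, i.e. the $k$-algebra of polynomials in $x$ over $k$ with zero constant term (with basis $x,x^2,x^3,\dots$). A $T$-space of a $k$-algebra $A$ is a $k$-linear subspace of $A$ that is invariant under all $k$-algebra endomorphisms of $A$. The $T$-space generated by a subset $H\subseteq A$ is the smallest $T$-space of $A$ containing $H$. A maximal $T$-space is a maximal element, under inclusion, of the set of proper $T$-spaces of $A$. *)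

(* Defs.v *)
From HB Require Import structures.
From mathcomp Require Import all_boot all_algebra.
From mathcomp Require Import boolp classical_sets.

Set Implicit Arguments.
Unset Strict Implicit.
Unset Printing Implicit Defensive.

Import GRing.Theory.
Local Open Scope ring_scope.
Local Open Scope classical_set_scope.

(* Associative algebras over k in which no unit element is required; the
   algebras of the MathComp hierarchy are all unital. *)
HB.mixin Record Lmodule_isNonUnitalAlgebra (k : fieldType) A
    of GRing.Lmodule k A := {
  numul : A -> A -> A;
  numulA : associative numul;
  numul_linearl : forall u : A, linear (fun v => numul v u);
  numul_linearr : forall u : A, linear (fun v => numul u v);
}.

#[short(type="nuAlgType")]
HB.structure Definition NonUnitalAlgebra (k : fieldType) :=
  { A of Lmodule_isNonUnitalAlgebra k A & GRing.Lmodule k A }.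

Definition nualg_endo (k : fieldType) (A : nuAlgType k) (f : A -> A) : Prop :=
  linear f /\ {morph f : u v / numul u v}.

Definition Tspace (k : fieldType) (A : nuAlgType k) (V : set A) : Prop :=
  submod_closed (mem V) /\
  (forall f : A -> A, nualg_endo f -> f @` V `<=` V).

Definition Tspace_gen (k : fieldType) (A : nuAlgType k) (H : set A) : set A :=
  smallest (@Tspace k A) H.

Definition maximal_Tspace (k : fieldType) (A : nuAlgType k) (W : set A) :
    Prop :=
  [/\ Tspace W, W <> setT &
      ~ exists V : set A, [/\ Tspace V, W `<` V & V `<` setT]].

Definition const0 (k : fieldType) : {pred {poly k}} :=
  [pred p : {poly k} | p`_0 == 0].

Lemma const0_submod_closed (k : fieldType) : submod_closed (@const0 k).
Proof.
split=> [|a u v]; rewrite !inE ?coef0 //.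
by move=> /eqP u0 /eqP v0; rewrite coefD coefZ u0 v0 mulr0 addr0.
Qed.

HB.instance Definition _ (k : fieldType) :=
  GRing.isSubmodClosed.Build k {poly k} (@const0 k) (@const0_submod_closed k).

(* The algebra k[x]_0. *)
Record poly0 (k : fieldType) := Poly0 {
  poly0_val :> {poly k};
  poly0_valP : poly0_val \in @const0 k
}.

HB.instance Definition _ (k : fieldType) := [isSub for @poly0_val k].
HB.instance Definition _ (k : fieldType) := [Choice of poly0 k by <:].
HB.instance Definition _ (k : fieldType) :=
  [SubChoice_isSubZmodule of poly0 k by <:].
HB.instance Definition _ (k : fieldType) :=
  [SubZmodule_isSubLmodule of poly0 k by <:].

Lemma const0M (k : fieldType) (p r : poly0 k) :
  (p : {poly k}) * r \in @const0 k.
Proof.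
by rewrite inE coef0M (eqP (poly0_valP p)) mul0r.
Qed.

Definition poly0_mul (k : fieldType) (p r : poly0 k) : poly0 k :=
  Poly0 (const0M p r).

Lemma poly0_mulA (k : fieldType) : associative (@poly0_mul k).
Proof. by move=> p r s; apply: val_inj; rewrite /= mulrA. Qed.

Lemma poly0_mul_linearl (k : fieldType) (u : poly0 k) :
  linear (fun v => poly0_mul v u).
Proof.
by move=> a p r; apply: val_inj; rewrite /= mulrDl scalerAl.
Qed.

Lemma poly0_mul_linearr (k : fieldType) (u : poly0 k) :
  linear (fun v => poly0_mul u v).
Proof.
by move=> a p r; apply: val_inj; rewrite /= mulrDr scalerAr.
Qed.

HB.instance Definition _ (k : fieldType) :=
  Lmodule_isNonUnitalAlgebra.Build k (poly0 k)
    (@poly0_mulA k) (@poly0_mul_linearl k) (@poly0_mul_linearr k).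

(* Main.v *)
(* Let F = F_(q^2) contain k = F_q, so that elements of k[x]_0 act as functions
   F -> F vanishing at 0 and commuting with the Frobenius map y |-> y^q.  Then
   W_1 is exactly the set of polynomials mapping F into F_q: the generators are
   the trace and the norm, and conversely W_1 contains x^n (x^(q^2) - x) for all
   n and, modulo these, enough symmetric monomials to span the q-th power
   invariant functions.  Since x is not F_q-valued, W_1 is proper.  If a T-space
   V > W_1 contains f with f(alpha) outside F_q, compose f with an interpolating
   polynomial g sending a given conjugate pair {beta, beta^q} to
   {alpha, alpha^q} and the rest of F to 0.  As F / F_q is one-dimensional over
   F_q, multiples of such f o g correct any polynomial to an F_q-valued one. *)
Require Import Defs.
From HB Require Import structures.
From mathcomp Require Import all_boot all_algebra all_field.
From mathcomp Require Import boolp classical_sets.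
Import GRing.Theory.
Local Open Scope ring_scope.
Local Open Scope classical_set_scope.

(** * T-spaces of k[x]_0: closure under substitution *)

Section TspacesOfPolynomials.
Set Implicit Arguments.
Unset Strict Implicit.
Unset Printing Implicit Defensive.

Variable k : fieldType.
Implicit Types (V H : set (poly0 k)) (p g : {poly k}).

Lemma TspaceP V : Tspace V <->
  [/\ V 0, forall a u v, V u -> V v -> V (a *: u + v)
    & forall f u, nualg_endo f -> V u -> V (f u)].
Proof.
split=> [[[V0 Vl] Ve] | [V0 Vl Ve]].
  split=> [|a u v Vu Vv|f u fE Vu]; first by move: V0; rewrite inE.
    by have := Vl a u v (mem_set Vu) (mem_set Vv); rewrite inE.
  by apply: (Ve f fE); exists u.
split; last by move=> f fE _ [u Vu <-]; apply: Ve.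
split=> [|a u v]; first exact: mem_set.
by rewrite !inE => Vu Vv; apply: Vl.
Qed.

Lemma Tspace_Tspace_gen H : Tspace (Tspace_gen H).
Proof.
apply/TspaceP; split=> [|a u v Wu Wv|f u fE Wu] V
  [/[dup] TV /TspaceP[V0 Vl Ve] HV] //.
- by apply: Vl; [apply: Wu | apply: Wv].
- by apply: Ve => //; apply: Wu.
Qed.

Definition poly0X : poly0 k := @Poly0 k 'X (introT eqP (coefX k 0)).

(** Since x generates k[x]_0, an endomorphism is substitution of the image of x. The induction runs
    on the cofactor [r] in p = r x, so that every Horner step stays free of a constant term. *)
Lemma nualg_endo_comp (f : poly0 k -> poly0 k) (u : poly0 k) :
  nualg_endo f -> poly0_val (f u) = u \Po f poly0X.
Proof.
move=> [fl fM]; case: u => p p0.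
have [r def_p]: exists r, p = r * 'X.
  move: (p0); rewrite inE; elim/poly_ind: p {p0} => [|r c _].
    by exists 0; rewrite mul0r.
  by rewrite coefD coefMX coefC add0r => /eqP->; exists r; rewrite addr0.
have f0 : f 0 = 0 by have := fl (-1) 0 0; rewrite scaleN1r addNr scaleN1r addNr.
elim/poly_ind: r p p0 def_p => [|r c IHr] p p0 def_p.
  suff -> : Poly0 p0 = 0 by rewrite f0 comp_poly0.
  by apply: val_inj; rewrite /= def_p mul0r.
have rX0 : r * 'X \in @const0 k by rewrite inE coefMX.
have -> : Poly0 p0 = c *: poly0X + numul (Poly0 rX0) poly0X.
  by apply: val_inj; rewrite /= def_p mulrDl addrC mul_polyC.
rewrite fl fM /= (IHr _ rX0 erefl) /=.
by rewrite !rmorphD !rmorphM /= comp_polyZ comp_polyX.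
Qed.

(** Transports V into [{poly k}], where arithmetic and composition need no membership proofs. *)
Definition vals V : set {poly k} := @poly0_val k @` V.

Lemma valsP V (u : poly0 k) : vals V u -> V u.
Proof. by move=> [v Vv /val_inj <-]. Qed.

Section Closure.
Variable V : set (poly0 k).
Hypothesis TV : Tspace V.

Lemma vals0 : vals V 0.
Proof. by have /TspaceP[V0 _ _] := TV; exists 0. Qed.

Lemma vals_lin a p g : vals V p -> vals V g -> vals V (a *: p + g).
Proof.
have /TspaceP[_ Vl _] := TV; move=> [u Vu <-] [v Vv <-].
by exists (a *: u + v); first exact: Vl.
Qed.

Lemma valsD p g : vals V p -> vals V g -> vals V (p + g).
Proof. by move=> Vp Vg; have := vals_lin 1 Vp Vg; rewrite scale1r. Qed.

Lemma valsZ a p : vals V p -> vals V (a *: p).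
Proof. by move=> Vp; have := vals_lin a Vp vals0; rewrite addr0. Qed.

Lemma valsB p g : vals V p -> vals V g -> vals V (p - g).
Proof. by move=> Vp Vg; rewrite -scaleN1r; apply: valsD => //; apply: valsZ. Qed.

Lemma vals_sum (I : Type) (r : seq I) (P : pred I) (F : I -> {poly k}) :
  (forall i, P i -> vals V (F i)) -> vals V (\sum_(i <- r | P i) F i).
Proof. by move=> VF; apply: big_ind => //; [apply: vals0 | apply: valsD]. Qed.

Lemma vals_comp p g : vals V p -> g \in @const0 k -> vals V (p \Po g).
Proof.
have /TspaceP[_ _ Ve] := TV; move=> [u Vu <-] g0.
have comp0 (v : poly0 k) : (v : {poly k}) \Po g \in @const0 k.
  rewrite inE -horner_coef0 horner_comp.
  move: g0 (poly0_valP v); rewrite !inE -!horner_coef0 => /eqP ->.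
  by rewrite horner_coef0.
exists (Poly0 (comp0 u)) => //; apply: (Ve (fun v => Poly0 (comp0 v))) => //.
split=> [a v w | v w]; apply: val_inj; rewrite /=.
  by rewrite comp_polyD comp_polyZ.
by rewrite rmorphM.
Qed.

End Closure.
End TspacesOfPolynomials.

(** * The Frobenius map and the field F_(q^2) *)

Section Frobenius.
Set Implicit Arguments.
Unset Strict Implicit.
Unset Printing Implicit Defensive.

Variable k : finFieldType.
Notation q := #|k|.

(** q is a power of the characteristic, which [iota] carries to R. Both R = [L] and R = [{poly k}]
    occur below. *)
Lemma frobenius_add (R : comNzRingType) (iota : {rmorphism k -> R}) (x y : R) :
  (x + y) ^+ q = x ^+ q + y ^+ q.
Proof.
have [p _ kp] := finPcharP k.
apply: exprDn_pchar; apply: (@sub_in_pnat p).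
  by move=> r _ /eqP ->; apply: (rmorph_pchar iota kp).
by have := pprimeChar_pgroup kp; rewrite /pgroup.pgroup cardsT.
Qed.

Lemma frobenius_opp (R : comNzRingType) (iota : {rmorphism k -> R}) (x : R) :
  (- x) ^+ q = - x ^+ q.
Proof.
apply/eqP; rewrite -addr_eq0 -(frobenius_add iota) addNr expr0n.
by rewrite gtn_eqF // ltnW // finNzRing_gt1.
Qed.

Lemma natr_card (R : comNzRingType) (iota : {rmorphism k -> R}) : q%:R = 0 :> R.
Proof.
have [p _ kp] := finPcharP k.
have /p_natP[n def_q] : p.-nat q.
  by have := pprimeChar_pgroup kp; rewrite /pgroup.pgroup cardsT.
have n0 : (0 < n)%N by case: n def_q (finNzRing_gt1 k) => [-> |].
by rewrite def_q natrX (pcharf0 (rmorph_pchar iota kp)) expr0n gtn_eqF.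
Qed.

(** F_(q^2) is realised as the root list of X^(q^2) - X in a splitting field; the derivative is -1,
    so the roots are distinct. *)
Lemma exists_splitting_field :
  exists (L : fieldType) (iota : {rmorphism k -> L}) (rs : seq L),
    [/\ uniq rs, size rs = (q ^ 2)%N & forall y, (y \in rs) = (y ^+ (q ^ 2) == y)].
Proof.
have q1 : (1 < q)%N := finNzRing_gt1 k.
have N1 : (1 < q ^ 2)%N by rewrite (ltn_exp2l 0).
have size_p (R : nzRingType) : size ('X^(q ^ 2) - 'X : {poly R}) = (q ^ 2).+1.
  by rewrite size_polyDl ?size_polyXn // size_polyN size_polyX.
have /FinSplittingFieldFor[L [rs Dp _]] : 'X^(q ^ 2) - 'X != 0 :> {poly k}.
  by rewrite -size_poly_eq0 size_p.
rewrite /= rmorphB /= map_polyXn map_polyX in Dp.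
have mem_rs y : (y \in rs) = (y ^+ (q ^ 2) == y).
  by rewrite -root_prod_XsubC -(eqp_root Dp) /root !hornerE subr_eq0.
have q0 := natr_card (in_alg L).
exists L, (in_alg L), rs; split=> //.
  rewrite -separable_prod_XsubC -(eqp_separable Dp) unlock derivB derivX derivXn.
  rewrite -[_ *+ (q ^ 2)]mulr_natr natrX -polyC_natr q0 expr0n mulr0 sub0r.
  by rewrite -[- 1]scaleN1r coprimepZr ?oppr_eq0 ?oner_eq0 ?coprimep1.
apply: succn_inj. rewrite -(size_prod_XsubC _ id).
by rewrite -(eqp_size Dp) size_p.
Qed.

Variables (L : fieldType) (iota : {rmorphism k -> L}).
Definition ev (p : {poly k}) (y : L) : L := (map_poly iota p).[y].

Lemma evD p g y : ev (p + g) y = ev p y + ev g y.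
Proof. by rewrite /ev rmorphD hornerD. Qed.
Lemma evN p y : ev (- p) y = - ev p y.
Proof. by rewrite /ev rmorphN hornerN. Qed.
Lemma evM p g y : ev (p * g) y = ev p y * ev g y.
Proof. by rewrite /ev rmorphM hornerM. Qed.
Lemma evZ a p y : ev (a *: p) y = iota a * ev p y.
Proof. by rewrite /ev linearZ hornerZ. Qed.
Lemma evXn n y : ev 'X^n y = y ^+ n.
Proof. by rewrite /ev map_polyXn hornerXn. Qed.
Lemma evX y : ev 'X y = y.
Proof. by rewrite /ev map_polyX hornerX. Qed.
Lemma ev_comp p g y : ev (p \Po g) y = ev p (ev g y).
Proof. by rewrite /ev map_comp_poly horner_comp. Qed.
Lemma ev0 p : p \in @const0 k -> ev p 0 = 0.
Proof. by rewrite inE /ev horner_coef0 coef_map => /eqP ->; rewrite raddf0. Qed.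

Lemma iota_frobenius a : iota a ^+ q = iota a.
Proof. by rewrite -rmorphXn expf_card. Qed.

Lemma ev_frobenius p y : ev p (y ^+ q) = ev p y ^+ q.
Proof.
elim/poly_ind: p => [|p c IHp].
  rewrite /ev rmorph0 !horner0 expr0n gtn_eqF // ltnW // finNzRing_gt1 //.
rewrite !evD !evM IHp !evX (frobenius_add iota) exprMn.
by rewrite /ev map_polyC !hornerC iota_frobenius.
Qed.

(** X^q - X is the product of the X - a over a in k, so it has no roots outside the image of k. *)
Lemma frobenius_fixed y : y ^+ q = y -> exists a, y = iota a.
Proof.
move=> yq; have : root ('X^q - 'X) y by rewrite /root !hornerE yq subrr.
have -> : 'X^q - 'X = map_poly iota ('X^q - 'X).
  by rewrite rmorphB /= map_polyXn map_polyX.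
rewrite finField_genPoly rmorph_prod /= (eq_bigr (fun x => 'X - (iota x)%:P)).
  rewrite -(big_map iota xpredT (fun z => 'X - z%:P)) root_prod_XsubC.
  by case/mapP=> a _ ->; exists a.
by move=> i _; rewrite rmorphB /= map_polyX map_polyC.
Qed.

End Frobenius.

(** * Base-q digits of exponents below q^2 *)

Section DigitSwap.
Variable q : nat.
Hypothesis q_gt0 : (0 < q)%N.

(* Exchanges the base-q digits of n < q^2. *)
Definition digit_swap (n : nat) : nat := (n %/ q + n %% q * q)%N.

Lemma digit_swap_lt n : (n < q ^ 2 -> digit_swap n < q ^ 2)%N.
Proof.
move=> lt_n; have lt_d : (n %/ q < q)%N by rewrite ltn_divLR.
have lt_m := ltn_pmod n q_gt0; rewrite /digit_swap.
apply: (@leq_trans (q + n %% q * q)); first by rewrite ltn_add2r.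
by rewrite -mulSn leq_mul2r lt_m orbT.
Qed.

Lemma digit_swapE a b : (a < q)%N -> digit_swap (a + b * q) = (b + a * q)%N.
Proof.
move=> lt_a; rewrite /digit_swap [(a + _)%N]addnC divnMDl // divn_small //.
by rewrite addn0 modnMDl modn_small.
Qed.

Lemma digit_swapK n : (n < q ^ 2)%N -> digit_swap (digit_swap n) = n.
Proof.
by move=> lt_n; rewrite digit_swapE ?ltn_divLR // addnC -divn_eq.
Qed.

Definition ord_swap (n : 'I_(q ^ 2)) : 'I_(q ^ 2) :=
  Ordinal (digit_swap_lt (ltn_ord n)).

Lemma ord_swapK : involutive ord_swap.
Proof. by move=> n; apply: val_inj; rewrite /= digit_swapK. Qed.

End DigitSwap.

(** * Functions on F_(q^2) and the T-spaces containing W_1 *)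

(* [rs] enumerates the subfield F_(q^2) of [L]. *)
Section Maximality.
Set Implicit Arguments.
Unset Strict Implicit.
Unset Printing Implicit Defensive.

Variable k : finFieldType.
Notation q := #|k|.
Variables (L : fieldType) (iota : {rmorphism k -> L}) (rs : seq L).
Hypothesis rs_uniq : uniq rs.
Hypothesis rs_size : size rs = (q ^ 2)%N.
Hypothesis mem_rs : forall y, (y \in rs) = (y ^+ (q ^ 2) == y).
Notation ev := (ev iota).

Let q_gt1 : (1 < q)%N := finNzRing_gt1 k.
Let q_gt0 : (0 < q)%N := ltnW q_gt1.

Lemma frobenius_rs y : y \in rs -> y ^+ q ^+ q = y.
Proof. by rewrite mem_rs -exprM => /eqP. Qed.

Lemma rs_frobenius y : y \in rs -> y ^+ q \in rs.
Proof. by rewrite !mem_rs exprAC => /eqP ->. Qed.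

Lemma rs_ev p y : y \in rs -> ev p y \in rs.
Proof.
by move=> ry; rewrite mem_rs -mulnn exprM -!ev_frobenius frobenius_rs.
Qed.

Lemma zero_rs : 0 \in rs.
Proof. by rewrite mem_rs expr0n expn_eq0 gtn_eqF. Qed.

(** X^q - X has at most q roots, fewer than q^2. *)
Lemma exists_nonfixed : exists2 y, y \in rs & y ^+ q != y.
Proof.
apply/hasP; apply: contraT => /hasPn all_fixed.
have size_p : size ('X^q - 'X : {poly L}) = q.+1.
  by rewrite size_polyDl ?size_polyXn // size_polyN size_polyX.
have p_neq0 : 'X^q - 'X != 0 :> {poly L} by rewrite -size_poly_eq0 size_p.
have := max_poly_roots p_neq0 _ rs_uniq; rewrite size_p rs_size ltnS leqNgt.
rewrite ltn_Pmull //; apply; apply/allP => y /all_fixed; rewrite negbK.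
by rewrite /root !hornerE subr_eq0.
Qed.

Section Generated.
Variable V : set (poly0 k).
Hypothesis TV : Tspace V.
Hypothesis V_trace : vals V ('X + 'X^q).
Hypothesis V_norm : vals V 'X^(q.+1).

Lemma Xn_const0 n : (0 < n)%N -> 'X^n \in @const0 k.
Proof. by case: n => // n _; rewrite inE coefXn. Qed.

Lemma vals_trace n : (0 < n)%N -> vals V ('X^n + 'X^(n * q)).
Proof.
move=> n0; have := vals_comp TV V_trace (Xn_const0 n0).
by rewrite comp_polyD comp_polyX comp_Xn_poly exprM.
Qed.

Lemma vals_norm n : (0 < n)%N -> vals V 'X^(n + n * q).
Proof.
move=> n0; have := vals_comp TV V_norm (Xn_const0 n0).
by rewrite comp_Xn_poly -exprM mulnS.
Qed.

(** Polarization of the norm: expand (x^m + x^n)^(q+1) and remove the two pure norms. If m or n is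
    0, this is a trace. *)
Lemma vals_mixed m n : (0 < m + n)%N -> vals V ('X^(m + n * q) + 'X^(n + m * q)).
Proof.
have [-> | m0 _] := posnP m.
  by rewrite !add0n mul0n addn0 addrC; apply: vals_trace.
have [-> | n0] := posnP n.
  by rewrite !add0n mul0n addn0; apply: vals_trace.
have mn0 : 'X^m + 'X^n \in @const0 k by rewrite rpredD // Xn_const0.
have := valsB TV (valsB TV (vals_comp TV V_norm mn0) (vals_norm m0)) (vals_norm n0).
rewrite comp_Xn_poly exprS (frobenius_add (@polyC k)) -!exprM mulrDl !mulrDr -!exprD.
by rewrite -addrA -opprD (addrC 'X^(m + m * q)) addrACA addrK.
Qed.

(** The mixed element for (n, q) and the trace of x^(n+1) share the term x^(q+nq), which cancels in
    their difference. *)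
Lemma vals_frobenius2 n : vals V ('X^n * ('X^(q ^ 2) - 'X)).
Proof.
have := valsB TV (@vals_mixed n q _) (@vals_trace (n + 1) _).
rewrite addn1 addnC addn_gt0 q_gt0 => /(_ isT isT).
rewrite mulrBr -exprD -exprSr -mulnn mulSn.
by rewrite opprD addrACA subrr addr0.
Qed.

(* Every p is, modulo V, a combination of monomials of degree < q^2; on F_(q^2)
   raising to the power q permutes these by swapping the two base-q digits of
   the exponent, so the coefficients of p are invariant under that swap. *)
Lemma vals_fixed p : p \in @const0 k ->
  (forall y, y \in rs -> ev p y ^+ q = ev p y) -> vals V p.
Proof.
move=> p0 p_fixed; set D : {poly k} := 'X^(q ^ 2) - 'X.
have N1 : (1 < q ^ 2)%N by rewrite (ltn_exp2l 0).
have size_D : size D = (q ^ 2).+1.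
  by rewrite size_polyDl ?size_polyXn // size_polyN size_polyX.
have D_neq0 : D != 0 by rewrite -size_poly_eq0 size_D.
have VuD u : vals V (u * D).
  rewrite -[u]coefK poly_def mulr_suml; apply: vals_sum => // i _.
  by rewrite -scalerAl; apply: valsZ => //; apply: vals_frobenius2.
rewrite (divp_eq p D); set r := p %% D; apply: valsD => //.
have size_r : (size r <= q ^ 2)%N by rewrite -ltnS -size_D ltn_modp.
have evD0 y : y \in rs -> ev D y = 0.
  by rewrite mem_rs evD evN evXn evX => /eqP ->; rewrite subrr.
have ev_r y : y \in rs -> ev r y = ev p y.
  by move=> ry; rewrite [in RHS](divp_eq p D) evD evM evD0 // mulr0 add0r.
have r0 : r`_0 = 0.
  apply: (fmorph_inj iota); rewrite raddf0 -coef_map -horner_coef0.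
  by rewrite -/(ev r 0) ev_r ?zero_rs // ev0.
have def_r : r = \sum_(n < q ^ 2) r`_n *: 'X^n.
  rewrite -poly_def; apply/polyP => i; rewrite coef_poly.
  by case: ltnP => // /(leq_trans size_r) /(nth_default 0).
pose s := ord_swap q_gt0.
have r_swap n : (n < q ^ 2)%N -> r`_(digit_swap q n) = r`_n.
  move=> lt_n; apply: (fmorph_inj iota).
  (* On F_(q^2), r(y) = r(y)^q = r(y^q) = B(y), since y^(nq) depends only on the swapped digits of
     n. Both degrees are below q^2, so agreement at q^2 points forces equality. *)
  pose B := \poly_(i < q ^ 2) iota r`_(digit_swap q i).
  suff eqB : B = map_poly iota r.
    by rewrite -[RHS]coef_map -eqB coef_poly lt_n.
  apply/eqP; rewrite -subr_eq0; apply/eqP.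
  apply: (@roots_geq_poly_eq0 _ _ rs) => //; last first.
    rewrite rs_size (leq_trans (size_polyD _ _)) // geq_max size_polyN size_poly.
    by rewrite size_map_poly size_r.
  apply/allP => y ry; rewrite /root hornerD hornerN subr_eq0 -/(ev r y).
  rewrite ev_r // -p_fixed // -ev_r // -ev_frobenius /ev {1}def_r.
  rewrite horner_poly rmorph_sum horner_sum /=.
  rewrite (reindex_inj (inv_inj (ord_swapK q_gt0))) /=; apply/eqP/eq_bigr => i _.
  rewrite digit_swapK // map_polyZ hornerZ map_polyXn hornerXn; congr (_ * _).
  rewrite [in RHS](divn_eq i q) /digit_swap !exprD [(_ %/ _ * _)%N]mulnC.
  by rewrite [in RHS]exprM frobenius_rs // [(_ %% _ * _)%N]mulnC exprM.
have V_pair n : vals V (r`_n *: ('X^n + 'X^(digit_swap q n))).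
  have [-> | n0] := posnP n; first by rewrite r0 scale0r; apply: vals0.
  apply: valsZ => //; rewrite {1}(divn_eq n q) addnC.
  apply: vals_mixed; rewrite lt0n addn_eq0; apply/negP => /andP[/eqP m0 /eqP d0].
  by move: n0; rewrite (divn_eq n q) m0 d0.
(* The swap exchanges the exponents with n < s n and those with s n < n, giving mixed pairs; the
   remaining exponents are fixed, have equal digits, and give norms. *)
rewrite def_r (bigID (fun n : 'I_(q ^ 2) => n < s n)%N) /=.
rewrite [X in _ + X](bigID (fun n : 'I_(q ^ 2) => s n < n)%N) /=.
rewrite addrA; apply: valsD => //.
  rewrite [X in _ + X](reindex_inj (inv_inj (ord_swapK q_gt0))).
  rewrite [X in _ + X](eq_bigl (fun n : 'I_(q ^ 2) => n < s n)%N); last first.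
    by move=> n; rewrite /= digit_swapK //; case: ltngtP.
  rewrite -big_split; apply: vals_sum => // n _.
  by rewrite /= r_swap // -scalerDr; apply: V_pair.
apply: vals_sum => // n; rewrite -!leqNgt -eqn_leq => /eqP sn.
have [n_eq | n0] := posnP n; first by rewrite n_eq r0 scale0r; apply: vals0.
apply: valsZ => //; rewrite (divn_eq n q) addnC.
have eq_md : (n %% q = n %/ q)%N.
  rewrite -[in RHS]sn /= /digit_swap addnC divnMDl // divn_small ?addn0 //.
  by rewrite ltn_divLR.
rewrite eq_md; apply: vals_norm; rewrite lt0n; apply: contraL n0 => /eqP d0.
by rewrite (divn_eq n q) eq_md d0.
Qed.

Lemma trace_lift y : y \in rs -> exists a, iota a = y + y ^+ q.
Proof.
move=> ry; have [|a ->] := @frobenius_fixed k L iota (y + y ^+ q); last by exists a.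
by rewrite (frobenius_add iota) frobenius_rs // addrC.
Qed.

(** For y different from b, multiplying by b - y gives b^(q^2) - y^(q^2) = b - y. For y = b there
    are q^2 equal terms, summing to 0. Thus 1 minus the kernel is the indicator of b. *)
Lemma lagrange_kernel b y : b \in rs -> y \in rs ->
  \sum_(i < q ^ 2) b ^+ ((q ^ 2).-1 - i) * y ^+ i = (y != b)%:R.
Proof.
move=> rb ry; have [-> | neq_yb] := eqVneq y b.
  rewrite (eq_bigr (fun=> b ^+ (q ^ 2).-1)) => [|i _].
    by rewrite sumr_const card_ord -[LHS]mulr_natr natrX (natr_card iota) expr0n mulr0.
  by rewrite -exprD subnK // -ltnS prednK ?expn_gt0 ?q_gt0.
have := subrXX b y (q ^ 2); move: rb ry; rewrite !mem_rs => /eqP -> /eqP ->.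
rewrite -[X in X = _]mulr1; have nz : b - y != 0 by rewrite subr_eq0 eq_sym.
by move/(mulfI nz) => <-.
Qed.

(** Weight the indicators of beta and beta^q by alpha and alpha^q: the coefficients are then traces,
    hence in k. As beta is not fixed it is nonzero, so g(0) = 0. *)
Lemma interpolation alpha beta :
    alpha \in rs -> beta \in rs -> beta ^+ q != beta ->
  exists2 g, g \in @const0 k & forall y, y \in rs ->
    ev g y = if y == beta then alpha else if y == beta ^+ q then alpha ^+ q else 0.
Proof.
move=> ra rb nfb; have rbq := rs_frobenius rb.
have rM x y : x \in rs -> y \in rs -> x * y \in rs.
  by rewrite !mem_rs exprMn => /eqP -> /eqP ->.
have rX x n : x \in rs -> x ^+ n \in rs.
  by rewrite !mem_rs exprAC => /eqP ->.
have [a def_a] := trace_lift ra.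
have c_ex i : exists c, iota c =
    alpha * beta ^+ ((q ^ 2).-1 - i) + alpha ^+ q * (beta ^+ q) ^+ ((q ^ 2).-1 - i).
  have [c def_c] := trace_lift (rM _ _ ra (rX _ ((q ^ 2).-1 - i)%N rb)).
  by exists c; rewrite def_c exprMn [_ ^+ q ^+ (_ - _)]exprAC.
have [t def_t] := choice c_ex.
pose g := a%:P - \poly_(i < q ^ 2) t i.
have ev_g y : y \in rs ->
    ev g y = if y == beta then alpha else if y == beta ^+ q then alpha ^+ q else 0.
  move=> ry; have -> : ev g y = alpha * (1 - (y != beta)%:R) +
                               alpha ^+ q * (1 - (y != beta ^+ q)%:R).
    rewrite -(lagrange_kernel rb ry) -(lagrange_kernel rbq ry).
    rewrite /ev /g rmorphB hornerD hornerN /= map_polyC hornerC /= def_a.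
    rewrite poly_def rmorph_sum horner_sum !mulrBr !mulr1 addrACA -opprD; congr (_ - _).
    rewrite !mulr_sumr -big_split; apply: eq_bigr => i _ /=.
    by rewrite map_polyZ hornerZ map_polyXn hornerXn def_t mulrDl !mulrA.
  have [-> | _] := eqVneq y beta.
    by rewrite eq_sym nfb subr0 subrr mulr1 mulr0 addr0.
  by case: eqVneq => _; rewrite /= ?subr0 ?subrr ?mulr1 ?mulr0 ?addr0 ?add0r.
exists g => //; rewrite inE -(fmorph_eq0 iota) -coef_map -horner_coef0 -/(ev g 0).
rewrite ev_g ?zero_rs //; have nz_b : beta != 0.
  by apply: contraNneq nfb => ->; rewrite expr0n gtn_eqF.
rewrite [0 == beta]eq_sym (negPf nz_b).
by rewrite [0 == _]eq_sym expf_eq0 q_gt0 (negPf nz_b).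
Qed.

(* The values outside F_q are corrected one conjugate pair at a time, by
   subtracting a multiple of f \Po g with g supported on that pair. *)
Lemma vals_full f alpha :
    vals V f -> alpha \in rs -> ev f alpha ^+ q != ev f alpha ->
  forall p, p \in @const0 k -> vals V p.
Proof.
move=> Vf ra nfa p p0.
(* [s] lists the points where p may still take values outside F_q; for s = [rs] the condition is
   vacuous. *)
suff main : forall (s : seq L) p, p \in @const0 k ->
    (forall y, y \in rs -> y \notin s -> ev p y ^+ q = ev p y) -> vals V p.
  by apply: (main rs) => // y ->.
elim=> [|beta s IHs] {p0}p p0 p_fixed.
  by apply: vals_fixed => // y ry; apply: p_fixed.
have [rb | nrb] := boolP (beta \in rs); last first.
  apply: IHs => // y ry nsy; apply: p_fixed; rewrite ?inE // negb_or nsy andbT.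
  by apply: contraNneq nrb => <-.
have [fb | nfb] := eqVneq (ev p beta ^+ q) (ev p beta).
  apply: IHs => // y ry nsy; have [-> // | ny] := eqVneq y beta.
  by apply: p_fixed; rewrite // inE negb_or ny.
have nb : beta ^+ q != beta by apply: contraNneq nfb => eqb; rewrite -ev_frobenius eqb.
have [g g0 ev_g] := interpolation ra rb nb.
have f0 : f \in @const0 k by case: Vf => u _ <-; apply: poly0_valP.
set u := ev f alpha in nfa *; set v := ev p beta in nfb *.
have nz : u - u ^+ q != 0 by rewrite subr_eq0 eq_sym.
(* Frobenius negates both v - v^q and u - u^q, so the quotient lies in k; it is chosen to make v - a
   u Frobenius-fixed. *)
have [|a def_a] := @frobenius_fixed k L iota ((v - v ^+ q) / (u - u ^+ q)).
  rewrite exprMn exprVn !(frobenius_add iota) !(frobenius_opp iota).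
  rewrite !frobenius_rs ?rs_ev //.
  by rewrite -(opprB v) -(opprB u) invrN mulrNN.
pose h := f \Po g.
have Vh : vals V h by apply: vals_comp.
have h0 : h \in @const0 k by case: Vh => w _ <-; apply: poly0_valP.
rewrite -(subrK (a *: h) p); apply: valsD => //; last exact: valsZ.
have fixed_b : ev (p - a *: h) beta ^+ q = ev (p - a *: h) beta.
  rewrite evD evN evZ ev_comp ev_g // eqxx -/u -/v.
  rewrite (frobenius_add iota) (frobenius_opp iota) exprMn iota_frobenius.
  apply/eqP; rewrite subr_eq -addrA [- _ + _]addrC -opprB -mulrBr -def_a.
  by rewrite divfK // opprB addrC subrK.
apply: IHs; first by rewrite rpredB // rpredZ.
move=> y ry nsy; have [-> // | ny] := eqVneq y beta.
(* The value at beta^q is the conjugate of the corrected value at beta; at all other points g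
   vanishes and p is unchanged. *)
have [-> | nyq] := eqVneq y (beta ^+ q); first by rewrite ev_frobenius fixed_b.
rewrite evD evN evZ ev_comp ev_g // (negPf ny) (negPf nyq) ev0 // mulr0 subr0.
by apply: p_fixed; rewrite // inE negb_or ny.
Qed.

End Generated.
End Maximality.

(** * Properness and maximality of W_1 *)

Theorem theorem4p1 (k : finFieldType) (q : nat) (hq : #|k| = q) :
  maximal_Tspace
    (Tspace_gen [set w : poly0 k | poly0_val w = 'X + 'X^q
                                \/ poly0_val w = 'X^(q.+1)]).
Proof.
subst q; have q_gt0 : (0 < #|k|)%N by apply: ltnW (finNzRing_gt1 k).
have [L [iota [rs [rs_uniq rs_size mem_rs]]]] := exists_splitting_field k.
set H := [set w | _]; split; first exact: Tspace_Tspace_gen.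
  move=> W_full; have [y ry] := exists_nonfixed rs_uniq rs_size.
  (* The polynomials that are F_q-valued on F_(q^2) form a T-space containing both generators but
     not x. *)
  pose F := [set u : poly0 k |
    forall y, y \in rs -> ev iota u y ^+ #|k| = ev iota u y].
  have TF : Tspace F.
    apply/TspaceP; split=> [z rz|a u v Fu Fv z rz|f u fE Fu z rz].
    - by rewrite /ev rmorph0 horner0 expr0n gtn_eqF.
    - rewrite /= evD evZ (frobenius_add iota) exprMn iota_frobenius.
      by rewrite Fu // Fv.
    rewrite (nualg_endo_comp _ fE) ev_comp; apply: Fu.
    exact: rs_ev.
  have HF : H `<=` F.
    move=> w Hw z rz; case: Hw => /= ->; rewrite ?evD ?evX !evXn.
      by rewrite (frobenius_add iota) (frobenius_rs mem_rs) // addrC.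
    by rewrite !exprS exprMn (frobenius_rs mem_rs) // mulrC.
  have : Tspace_gen H (poly0X k) by rewrite W_full.
  move/(smallest_sub TF HF) => /(_ y ry) /=; rewrite !evX => ->.
  by rewrite eqxx.
move=> [V [TV [WV nVW] [_ nV]]]; apply: nV => u _.
have gens (T : set (poly0 k)) :
    H `<=` T -> vals T ('X + 'X^#|k|) /\ vals T 'X^(#|k|.+1).
  move=> HT; have X0 : 'X \in @const0 k by rewrite inE coefX.
  have t0 : 'X + 'X^#|k| \in @const0 k by rewrite rpredD // Xn_const0.
  split; first by exists (Poly0 t0) => //; apply: HT; left.
  by exists (Poly0 (Xn_const0 k (ltn0Sn #|k|))) => //; apply: HT; right.
have HW : H `<=` Tspace_gen H by move=> w Hw T [_]; apply.
have [V_trace V_norm] := gens V (subset_trans HW WV).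
have [W_trace W_norm] := gens _ HW.
have [v Vv nWv] : exists2 v, V v & ~ Tspace_gen H v.
  apply: contrapT => noV; apply: nVW => v Vv; apply: contrapT => nWv.
  by apply: noV; exists v.
have Vfv : vals V v by exists v.
(* Either v has a value outside F_q and V is everything, or v already lies in W_1, a
   contradiction. *)
have [/hasP[y ry nfy]|/hasPn all_fixed] :=
    boolP (has (fun y => ev iota v y ^+ #|k| != ev iota v y) rs).
  apply: valsP; apply: (vals_full rs_uniq rs_size mem_rs TV V_trace V_norm Vfv ry nfy).
  exact: poly0_valP.
case: nWv; apply: valsP; apply: (vals_fixed (iota := iota) rs_uniq rs_size
  mem_rs (@Tspace_Tspace_gen k H) W_trace W_norm); first exact: poly0_valP.
by move=> y /all_fixed /negbNE /eqP.
Qed.
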